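(* Let $(\mathbf Q^{(t)})_{t\ge1}$ and $(\boldsymbol\varphi^{(t)})_{t\ge0}$ be iterates generated by the alternating optimization algorithm described in the context. Then the value of the objective function (the transmit power) is non-increasing over the iterations: for every iteration $t\geq 2$, the objective value at $(\mathbf Q^{(t)},\boldsymbol\varphi^{(t)})$ is at most the objective value at $(\mathbf Q^{(t-1)},\boldsymbol\varphi^{(t-1)})$, i.e. $$\mathrm{tr}(\mathbf Q^{(t)})\leq\mathrm{tr}(\mathbf Q^{(t-1)}).$$
   Context: Setting. $M,N_1,N_2,K,L$ are positive integers and $\alpha,\sigma^2,R_s,\gamma>0$ are real constants. Channel matrices: $\mathbf H_1\in\mathbb C^{N_1\times M}$, $\mathbf H_2\in\mathbb C^{N_2\times M}$, $\mathbf H_3\in\mathbb C^{K\times M}$, $\mathbf G_1\in\mathbb C^{N_1\times K}$, $\mathbf G_2\in\mathbb C^{N_2\times K}$. $(\cdot)^H$ is the conjugate transpose, $(\cdot)^\dagger$ the complex conjugate of a scalar, $j$ the imaginary unit. $\mathcal A=\{e^{j\phi}:\phi\in[0,2\pi)\}$. For $\boldsymbol\varphi=(\varphi_1,\dots,\varphi_K)^T$ put $\mathbf F_m=\mathbf F_m(\boldsymbol\varphi)=\sqrt\alpha\,\mathbf G_m\,\mathrm{diag}(\boldsymbol\varphi)\,\mathbf H_3$ for $m=1,2$. For a Hermitian positive semidefinite $\mathbf Q\in\mathbb C^{M\times M}$ (playing the role of $\mathbf W\mathbf W^H$, with $\mathbf W$ the transmit beamforming matrix) define $$R_p(\mathbf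 Q;\boldsymbol\varphi)=\tfrac12\sum_{\epsilon\in\{1,-1\}}\log_2\det\big(\mathbf I_{N_1}+\tfrac1{\sigma^2}(\mathbf H_1+\epsilon\mathbf F_1)\mathbf Q(\mathbf H_1+\epsilon\mathbf F_1)^H\big),$$ $$R_{b,s}(\mathbf Q;\boldsymbol\varphi)=\tfrac12\sum_{\epsilon\in\{1,-1\}}\log_2\det\big(\mathbf I_{N_2}+\tfrac1{\sigma^2}(\mathbf H_2+\epsilon\mathbf F_2)\mathbf Q(\mathbf H_2+\epsilon\mathbf F_2)^H\big),$$ $$\gamma_{b,c}(\mathbf Q;\boldsymbol\varphi)=\tfrac{L}{\sigma^2}\mathrm{tr}(\mathbf F_2\mathbf Q\mathbf F_2^H).$$ The overall problem is to minimize the transmit power $\mathrm{tr}(\mathbf Q)$ over $\mathbf Q\succeq0$ and $\boldsymbol\varphi\in\mathcal A^K$ subject to $R_p\ge R_s$, $R_{b,s}\ge R_s$, $\gamma_{b,c}\ge\gamma$. Subproblem in $\mathbf Q$ (given $\boldsymbol\varphi$): minimize $\mathrm{tr}(\mathbf Q)$ over $\mathbf Q\succeq0$ subject to $R_p(\mathbf Q;\boldsymbol\varphi)\ge R_s$, $R_{b,s}(\mathbf Q;\boldsymbol\varphi)\ge R_s$, $\gamma_{b,c}(\mathbf Q;\boldsymbol\varphi)\ge\gamma$. Functions of a single $\varphi_k$ (given $\mathbf Q$ and $\varphi_i\in\mathcal A$, $i\ne k$). Let $\mathbf g_{m,i}$ be the $i$-th column of $\mathbf G_m$ and $\mathbf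 h_{3,i}$ the $i$-th column of $\mathbf H_3^H$. For $m,n\in\{1,2\}$ let $$\mathbf A_{m,n,k}=\mathbf I_{N_m}+\tfrac1{\sigma^2}\mathbf H_m\mathbf Q\mathbf H_m^H+\tfrac{\alpha}{\sigma^2}\Big(\sum_{i\ne k}\varphi_i\mathbf g_{m,i}\mathbf h_{3,i}^H\Big)\mathbf Q\Big(\sum_{i\ne k}\varphi_i^\dagger\mathbf h_{3,i}\mathbf g_{m,i}^H\Big)+\tfrac{\alpha}{\sigma^2}\mathbf g_{m,k}\mathbf h_{3,k}^H\mathbf Q\mathbf h_{3,k}\mathbf g_{m,k}^H+(-1)^n\tfrac{\sqrt\alpha}{\sigma^2}\sum_{i\ne k}\big(\varphi_i\mathbf g_{m,i}\mathbf h_{3,i}^H\mathbf Q\mathbf H_m^H+\varphi_i^\dagger\mathbf H_m\mathbf Q\mathbf h_{3,i}\mathbf g_{m,i}^H\big),$$ $$\mathbf B_{m,n,k}=(-1)^n\tfrac{\sqrt\alpha}{\sigma^2}\mathbf g_{m,k}\mathbf h_{3,k}^H\mathbf Q\mathbf H_m^H+\tfrac{\alpha}{\sigma^2}\sum_{i\ne k}\varphi_i^\dagger\mathbf g_{m,k}\mathbf h_{3,k}^H\mathbf Q\mathbf h_{3,i}\mathbf g_{m,i}^H.$$ For complex $\varphi_k$ with $|\varphi_k|\le1$ set: $f_{m,n}(\varphi_k)=\log_2\det(\mathbf A_{m,n,k})$ if $\mathrm{rank}(\mathbf A_{m,n,k}^{-1}\mathbf B_{m,n,k})=0$; $f_{m,n}(\varphi_k)=\log_2\det(\mathbf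 A_{m,n,k}-\mathbf B_{m,n,k}^H\mathbf A_{m,n,k}^{-1}\mathbf B_{m,n,k})$ if $\mathrm{rank}(\mathbf A_{m,n,k}^{-1}\mathbf B_{m,n,k})=1$ and $\mathrm{tr}(\mathbf A_{m,n,k}^{-1}\mathbf B_{m,n,k})=0$; and otherwise $f_{m,n}(\varphi_k)=\log_2(1+|\lambda|^2(1-\tilde v v)+2\mathrm{Re}(\varphi_k\lambda))+\log_2\det(\mathbf A_{m,n,k})$, where $\lambda$ is the non-zero eigenvalue in the eigendecomposition $\mathbf A_{m,n,k}^{-1}\mathbf B_{m,n,k}=\mathbf U\,\mathrm{diag}\{\lambda,0,\dots,0\}\mathbf U^{-1}$ and $v,\tilde v$ are the $(1,1)$ entries of $(\mathbf U^H\mathbf A_{m,n,k}\mathbf U)^{-1}$ and $\mathbf U^H\mathbf A_{m,n,k}\mathbf U$. Also $f_3(\varphi_k)=\frac{\alpha L}{\sigma^2}(A_k+2\mathrm{Re}(\varphi_kB_k))$ with $A_k=\mathbf g_{2,k}^H\mathbf g_{2,k}\mathbf h_{3,k}^H\mathbf Q\mathbf h_{3,k}+\sum_{i_1\ne k,i_2\ne k}\varphi_{i_1}\varphi_{i_2}^\dagger\mathbf g_{2,i_2}^H\mathbf g_{2,i_1}\mathbf h_{3,i_1}^H\mathbf Q\mathbf h_{3,i_2}$ and $B_k=\sum_{i\ne k}\varphi_i^\dagger\mathbf g_{2,i}^H\mathbf g_{2,k}\mathbf h_{3,k}^H\mathbf Q\mathbf h_{3,i}$. For $|\varphi_k|=1$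 one has $R_p=\frac12(f_{1,1}+f_{1,2})$, $R_{b,s}=\frac12(f_{2,1}+f_{2,2})$, $\gamma_{b,c}=f_3$. Subproblem in $\varphi_k$ (relaxed): maximize $\tau\in\mathbb R$ over $(\varphi_k,\tau)$ subject to $\frac{f_{1,1}(\varphi_k)+f_{1,2}(\varphi_k)}{2R_s}\ge\tau$, $\frac{f_{2,1}(\varphi_k)+f_{2,2}(\varphi_k)}{2R_s}\ge\tau$, $\frac{f_3(\varphi_k)}{\gamma}\ge\tau$, $\tau\ge1$, $|\varphi_k|^2\le1$. If $\varphi_k^*$ is an optimal solution, its projection onto $\mathcal A$ is $\varphi_k^\star=\exp(j\arg(\varphi_k^* ))$. Algorithm. Initialization: $\boldsymbol\varphi^{(0)}=e^{j(\pi/2+\arg(\mathbf x^H\mathbf H_1\mathbf y))}e^{-j\arg(\mathrm{diag}(\mathbf x^H\mathbf G_1)\mathbf H_3\mathbf y)}$ (argument and exponential taken entrywise on vectors), where $\mathbf x,\mathbf y$ are unit-norm left and right singular vectors of $\mathbf H_1+\sqrt\alpha\,\mathbf G_1\mathbf H_3$ for its largest singular value. For $t=1,2,\dots$: (1) let $\mathbf Q^{(t)}$ be an optimal solution of the subproblem in $\mathbf Q$ with $\boldsymbol\varphi=\boldsymbol\varphi^{(t-1)}$ (assumed to exist); (2) for $k=1,\dots,K$ in order, solve the relaxed subproblem in $\varphi_k$ with $\mathbf Q=\mathbf Q^{(t)}$, $\varphi_i=\varphi_i^{(t)}$ for $i<k$ and $\varphi_i=\varphi_i^{(t-1)}$ for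 $i>k$, and form the projection $\varphi_k^\star$; set $\varphi_k^{(t)}=\varphi_k^\star$ if $\varphi_k^\star$ satisfies all the constraints (i.e. the three ratios above at $\varphi_k^\star$ are all at least $1$), and $\varphi_k^{(t)}=\varphi_k^{(t-1)}$ otherwise. The objective value at $(\mathbf Q^{(t)},\boldsymbol\varphi^{(t)})$ is $\mathrm{tr}(\mathbf Q^{(t)})$, written $\mathrm{tr}(\mathbf Q^{(t)};\boldsymbol\varphi^{(t)})$ in the paper. *)

(* Defs.v *)
From HB Require Import structures.
From mathcomp Require Import all_boot all_order all_algebra.
From mathcomp Require Import spectral.
From mathcomp Require Import all_classical all_reals all_analysis.
From mathcomp Require Import complex.

Set Implicit Arguments.
Unset Strict Implicit.
Unset Printing Implicit Defensive.
Import Order.TTheory GRing.Theory Num.Theory.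
Local Open Scope complex_scope.
Local Open Scope sesquilinear_scope.
Local Open Scope classical_set_scope.
Local Open Scope ring_scope.

Section ComplexPreliminaries.
Variable R : realType.
Local Notation C := R[i].

Definition log2 (x : R) : R := ln x / ln 2.

Definition expi (t : R) : C := cos t +i* sin t.

(* [t] is an argument of [z], with no branch fixed: arguments only ever occur
   below inside [expi].  Every [t] is an argument of 0. *)
Definition is_arg (z : C) (t : R) : Prop := z = `|z| * expi t.

Definition psdmx n (Q : 'M[C]_n) : Prop :=
  Q \is hermsymmx /\ forall x : 'cV[C]_n, 0 <= (x^t* *m Q *m x) 0 0.

Definition unit_vector n (x : 'cV[C]_n) : Prop := \sum_i `|x i 0| ^+ 2 = 1.

(* Requiring both equations makes 0 a singular value exactly when the rank is
   less than min(m, n), as with the usual list of min(m, n) singular values. *)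
Definition singular_triple m n (A : 'M[C]_(m, n)) (s : R)
    (x : 'cV[C]_m) (y : 'cV[C]_n) : Prop :=
  [/\ 0 <= s, unit_vector x, unit_vector y,
      A *m y = s%:C *: x & A^t* *m x = s%:C *: y].

Definition top_singular_vectors m n (A : 'M[C]_(m, n))
    (x : 'cV[C]_m) (y : 'cV[C]_n) : Prop :=
  exists s : R, singular_triple A s x y /\
    forall s' x' y', singular_triple A s' x' y' -> s' <= s.

End ComplexPreliminaries.

(* All dimensions are positive, hence the successors. *)
Record system (R : realType) (M N1 N2 K : nat) := System {
  alpha : R;
  sigma2 : R;
  Rs : R;
  gamma : R;
  L : nat;
  H1 : 'M[R[i]]_(N1.+1, M.+1);
  H2 : 'M[R[i]]_(N2.+1, M.+1);
  H3 : 'M[R[i]]_(K.+1, M.+1);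
  G1 : 'M[R[i]]_(N1.+1, K.+1);
  G2 : 'M[R[i]]_(N2.+1, K.+1)
}.

Section Model.
Variables (R : realType) (M N1 N2 K : nat) (sys : system R M N1 N2 K).
Local Notation C := R[i].
Implicit Types (Q : 'M[C]_M.+1) (phi : 'rV[C]_K.+1) (k : 'I_K.+1).

Section Link.
Variables (N : nat) (H : 'M[C]_(N.+1, M.+1)) (G : 'M[C]_(N.+1, K.+1)).

Definition F phi : 'M[C]_(N.+1, M.+1) :=
  (Num.sqrt (alpha sys))%:C *: (G *m diag_mx phi *m H3 sys).

(* The determinants below are real; [complex.Re] only changes the type to [R]. *)
Definition rate Q phi : R :=
  2^-1 * \sum_(e <- [:: 1; -1 : C])
    log2 (complex.Re (\det (1%:M + (sigma2 sys)^-1%:C *: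
                 ((H + e *: F phi) *m Q *m (H + e *: F phi)^t*)))).

Local Notation g i := (col i G).
Local Notation h i := (col i ((H3 sys)^t*)).

Definition Amx Q phi k (n : nat) : 'M[C]_N.+1 :=
  1%:M + (sigma2 sys)^-1%:C *: (H *m Q *m H^t*)
  + (alpha sys / sigma2 sys)%:C *:
      ((\sum_(i | i != k) phi 0 i *: (g i *m (h i)^t*)) *m Q *m
       (\sum_(i | i != k) (phi 0 i)^* *: (h i *m (g i)^t*)))
  + (alpha sys / sigma2 sys)%:C *:
      (g k *m (h k)^t* *m Q *m h k *m (g k)^t*)
  + ((-1) ^+ n * (Num.sqrt (alpha sys) / sigma2 sys))%:C *:
      \sum_(i | i != k) (phi 0 i *: (g i *m (h i)^t* *m Q *m H^t*)
                         + (phi 0 i)^* *: (H *m Q *m h i *m (g i)^t*)).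

Definition Bmx Q phi k (n : nat) : 'M[C]_N.+1 :=
  ((-1) ^+ n * (Num.sqrt (alpha sys) / sigma2 sys))%:C *:
    (g k *m (h k)^t* *m Q *m H^t*)
  + (alpha sys / sigma2 sys)%:C *:
      \sum_(i | i != k)
        (phi 0 i)^* *: (g k *m (h k)^t* *m Q *m h i *m (g i)^t*).

Definition rank1_eigendecomposition (X U : 'M[C]_N.+1) (lam : C) : Prop :=
  [/\ U \in unitmx, lam != 0 &
      X = U *m diag_mx (\row_i (if i == ord0 then lam else 0)) *m invmx U].

(* In the last case the eigendecomposition is chosen; the value depends on U
   only through the product of v and v~, which is the same for all choices. *)
Definition fval Q phi k (n : nat) (z : C) : R :=
  let A := Amx Q phi k n in
  let B := Bmx Q phi k n in
  let X := invmx A *m B in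
  if \rank X == 0%N then log2 (complex.Re (\det A))
  else if (\rank X == 1%N) && (\tr X == 0) then
    log2 (complex.Re (\det (A - B^t* *m invmx A *m B)))
  else
    let Ul := xget (0, 0) [set p : 'M[C]_N.+1 * C |
                             rank1_eigendecomposition X p.1 p.2] in
    let U := Ul.1 in
    let lam := Ul.2 in
    let v := (invmx (U^t* *m A *m U)) ord0 ord0 in
    let vt := (U^t* *m A *m U) ord0 ord0 in
    log2 (complex.Re (1 + `|lam| ^+ 2 * (1 - vt * v)) + 2 * complex.Re (z * lam))
    + log2 (complex.Re (\det A)).

End Link.

Definition Rp Q phi : R := rate (H1 sys) (G1 sys) Q phi.
Definition Rbs Q phi : R := rate (H2 sys) (G2 sys) Q phi.
Definition gamma_bc Q phi : R :=
  (L sys)%:R / sigma2 sys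
  * complex.Re (\tr (F (G2 sys) phi *m Q *m (F (G2 sys) phi)^t*)).

Definition power Q : R := complex.Re (\tr Q).

Definition feasibleQ phi Q : Prop :=
  [/\ psdmx Q, Rs sys <= Rp Q phi, Rs sys <= Rbs Q phi
    & gamma sys <= gamma_bc Q phi].

Definition optimalQ phi Q : Prop :=
  feasibleQ phi Q /\ forall Q', feasibleQ phi Q' -> power Q <= power Q'.

Definition f1 Q phi k n z : R := fval (H1 sys) (G1 sys) Q phi k n z.
Definition f2 Q phi k n z : R := fval (H2 sys) (G2 sys) Q phi k n z.

Local Notation g2 i := (col i (G2 sys)).
Local Notation h3 i := (col i ((H3 sys)^t*)).

Definition Ak Q phi k : C :=
  ((g2 k)^t* *m g2 k) 0 0 * ((h3 k)^t* *m Q *m h3 k) 0 0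
  + \sum_(i1 | i1 != k) \sum_(i2 | i2 != k)
      phi 0 i1 * (phi 0 i2)^* * ((g2 i2)^t* *m g2 i1) 0 0
      * ((h3 i1)^t* *m Q *m h3 i2) 0 0.

Definition Bk Q phi k : C :=
  \sum_(i | i != k) (phi 0 i)^* * ((g2 i)^t* *m g2 k) 0 0
                    * ((h3 k)^t* *m Q *m h3 i) 0 0.

Definition f3 Q phi k (z : C) : R :=
  alpha sys * (L sys)%:R / sigma2 sys
  * (complex.Re (Ak Q phi k) + 2 * complex.Re (z * Bk Q phi k)).

(* In the predicates on the k-th phase, the entry [phi 0 k] is irrelevant:
   the phase under optimization is [z]. *)
Definition ratios_ge Q phi k (z : C) (tau : R) : Prop :=
  [/\ tau <= (f1 Q phi k 1 z + f1 Q phi k 2 z) / (2 * Rs sys),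
      tau <= (f2 Q phi k 1 z + f2 Q phi k 2 z) / (2 * Rs sys)
    & tau <= f3 Q phi k z / gamma sys].

Definition relaxed_feasible Q phi k (z : C) (tau : R) : Prop :=
  [/\ ratios_ge Q phi k z tau, 1 <= tau & `|z| ^+ 2 <= 1].

Definition relaxed_optimal Q phi k (z : C) (tau : R) : Prop :=
  relaxed_feasible Q phi k z tau /\
  forall z' tau', relaxed_feasible Q phi k z' tau' -> tau' <= tau.

Definition initial_phases phi : Prop :=
  exists (x : 'cV[C]_N1.+1) (y : 'cV[C]_M.+1) (t0 : R) (t : 'I_K.+1 -> R),
  [/\ top_singular_vectors
        (H1 sys + (Num.sqrt (alpha sys))%:C *: (G1 sys *m H3 sys)) x y,
      is_arg ((x^t* *m H1 sys *m y) 0 0) t0,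
      forall k, is_arg ((diag_mx (x^t* *m G1 sys) *m H3 sys *m y) k 0) (t k)
    & forall k, phi 0 k = expi (pi / 2 + t0) * expi (- t k)].

Definition mixed_phases phi' phi k : 'rV[C]_K.+1 :=
  \row_i (if (i < k)%N then phi' 0 i else phi 0 i).

Definition phase_update Q phi phi' k : Prop :=
  let psi := mixed_phases phi' phi k in
  exists (z : C) (tau t : R),
  [/\ relaxed_optimal Q psi k z tau, is_arg z t,
      ratios_ge Q psi k (expi t) 1 -> phi' 0 k = expi t
    & ~ ratios_ge Q psi k (expi t) 1 -> phi' 0 k = phi 0 k].

(* [Q 0] plays no role: the beamforming iterates start at index 1. *)
Definition ao_iterates (Q : nat -> 'M[C]_M.+1) (phi : nat -> 'rV[C]_K.+1) :
    Prop :=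
  initial_phases (phi 0%N) /\
  forall t, optimalQ (phi t) (Q t.+1) /\
            forall k, phase_update (Q t.+1) (phi t) (phi t.+1) k.

End Model.

(* Main.v *)
Require Import Defs.
From mathcomp Require Import all_boot all_order all_algebra spectral ring.
From mathcomp Require Import all_classical all_reals all_analysis.
From mathcomp Require Import complex.
Set Implicit Arguments.
Unset Strict Implicit.
Unset Printing Implicit Defensive.
Import Order.TTheory GRing.Theory Num.Theory.
Local Open Scope complex_scope.
Local Open Scope sesquilinear_scope.
Local Open Scope ring_scope.

(** Every accepted phase update keeps Q(t) feasible, so Q(t) is feasible for the
subproblem that defines Q(t+1), and optimality of Q(t+1) gives the descent.
What has to be shown is that the single-phase functions agree with the rates
on the unit circle.  For |z| = 1 the matrix inside the determinant is
A + z B + z^* B^H with A positive definite and B = g w of rank at most one.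
With X = A^-1 B, a = tr X and s = tr (X^H A X A^-1), Sylvester's identity
reduces it to a 2 x 2 determinant:
  det (A + z B + z^* B^H) = det A (1 + 2 Re (z a) + |a|^2 - s),
and the three cases in the definition of f_(m,n) are this formula for X = 0,
for a = 0, and for a = lambda, where s = |lambda|^2 v~ v. *)

(** * Determinants of low-rank perturbations *)

(** Sylvester's identity: the same two block matrices, multiplied in either order, give block
    triangular matrices whose determinants are the two sides. *)
Lemma det_1Dmulmx {R : comUnitRingType} m n (A : 'M[R]_(m, n)) (B : 'M[R]_(n, m)) :
  \det (1%:M + A *m B) = \det (1%:M + B *m A).
Proof.
have e1 : block_mx 1%:M (- A) B 1%:M *m block_mx 1%:M A 0 1%:M =
          block_mx 1%:M 0 B (1%:M + B *m A).
  rewrite mulmx_block !mulmx1 !mulmx0 !addr0 /=.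
  by rewrite mul1mx subrr [B *m A + _]addrC.
have e2 : block_mx 1%:M A 0 1%:M *m block_mx 1%:M (- A) B 1%:M =
          block_mx (1%:M + A *m B) 0 B 1%:M.
  by rewrite mulmx_block !mulmx1 !mul1mx !mul0mx !add0r addNr.
move/(congr1 determinant): e1; move/(congr1 determinant): e2.
by rewrite !det_mulmx !det_lblock !det1 mulr1 !mul1r => <- <-; rewrite mulrC.
Qed.

Lemma det_block11 {R : comUnitRingType} (a b c d : 'M[R]_1) :
  \det (block_mx a b c d) = a 0 0 * d 0 0 - b 0 0 * c 0 0.
Proof.
rewrite (expand_det_row _ (lshift 1 0)) big_split_ord !big_ord1 /cofactor.
rewrite !det_mx11 block_mxEul block_mxEur !mxE /=.
rewrite expr0 expr1 mul1r mulN1r mulrN.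
have -> : lift (lshift 1 (0 : 'I_1)) 0 = rshift 1 0 by exact: val_inj.
have -> : lift (rshift 1 (0 : 'I_1)) 0 = lshift 1 0 by exact: val_inj.
have sl : fintype.split (lshift 1 0 : 'I_(1 + 1)) = inl 0 := unsplitK (inl _).
have sr : fintype.split (rshift 1 0 : 'I_(1 + 1)) = inr 0 := unsplitK (inr _).
by rewrite sr !mxE sl sr.
Qed.

(** Factoring out A leaves 1 + A^-1 [u1 u2] [v1; v2], which Sylvester's identity turns into a 2 x 2
    determinant. *)
Lemma det_add_rank2 {R : comUnitRingType} n (A : 'M[R]_n) (u1 u2 : 'cV[R]_n)
    (v1 v2 : 'rV[R]_n) : A \in unitmx ->
  let p (v : 'rV[R]_n) (u : 'cV[R]_n) := (v *m invmx A *m u) 0 0 in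
  \det (A + u1 *m v1 + u2 *m v2) =
  \det A * ((1 + p v1 u1) * (1 + p v2 u2) - p v1 u2 * p v2 u1).
Proof.
move=> uA p.
have -> : A + u1 *m v1 + u2 *m v2 =
    A *m (1%:M + (invmx A *m row_mx u1 u2) *m col_mx v1 v2).
  by rewrite mulmxDr mulmx1 !mulmxA mulmxV // mul1mx mul_row_col addrA.
rewrite det_mulmx det_1Dmulmx mulmxA mul_col_mx mul_col_row.
rewrite [1%:M]scalar_mx_block add_block_mx det_block11 !add0r.
have D1 (X : 'M[R]_1) : (1%:M + X) 0 0 = 1 + X 0 0 by rewrite mxE mxE eqxx.
by rewrite !D1.
Qed.

(** * Conjugate transposes, the spectral bound and traces *)

Lemma trmxCD {C : numClosedFieldType} m n (A B : 'M[C]_(m, n)) :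
  (A + B)^t* = A^t* + B^t*.
Proof. by rewrite linearD /= map_mxD. Qed.

Lemma trmxCM {C : numClosedFieldType} m n p (A : 'M[C]_(m, n)) (B : 'M[C]_(n, p)) :
  (A *m B)^t* = B^t* *m A^t*.
Proof. by rewrite trmx_mul map_mxM. Qed.

Lemma trmxCZ {C : numClosedFieldType} m n (a : C) (A : 'M[C]_(m, n)) :
  (a *: A)^t* = a^* *: A^t*.
Proof. by rewrite linearZ /= map_mxZ. Qed.

Lemma trmxC_sum {C : numClosedFieldType} m n I r (P : pred I) (A : I -> 'M[C]_(m, n)) :
  (\sum_(i <- r | P i) A i)^t* = \sum_(i <- r | P i) (A i)^t*.
Proof. by rewrite linear_sum /= map_mx_sum. Qed.

Lemma trmxC_inv {C : numClosedFieldType} n (A : 'M[C]_n) :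
  (invmx A)^t* = invmx (A^t*).
Proof. by rewrite trmx_inv map_invmx. Qed.

Lemma hermsymmxP {C : numClosedFieldType} n (A : 'M[C]_n) :
  reflect (A^t* = A) (A \is hermsymmx).
Proof.
by apply: (iffP (is_hermitianmxP _ _ _)); rewrite expr0 scale1r => /esym.
Qed.

Lemma det_1Dpsd {R : realType} n (P : 'M[R[i]]_n) :
  psdmx P -> 0 < \det (1%:M + P).
Proof.
move=> [hP P0]; have uU := spectral_unitarymx P.
have /hermitian_normalmx /orthomx_spectralP eP := hP.
move: uU eP; set U := spectralmx P; set d := spectral_diag P => uU eP.
have uU' := unitarymx_unit uU.
have -> : 1%:M + P = invmx U *m (1%:M + diag_mx d) *m U.
  by rewrite mulmxDr mulmxDl mulmx1 mulVmx // -eP.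
rewrite !det_mulmx mulrAC -det_mulmx mulVmx // det1 mul1r.
have -> : 1%:M + diag_mx d = diag_mx (const_mx 1 + d).
  by rewrite linearD /= diag_const_mx.
rewrite det_diag; apply: prodr_gt0 => i _; rewrite !mxE.
apply: ltr_wpDr => //.
(* The quadratic form at the i-th eigenvector, the conjugate transpose of row i of U, equals d_i, so
   d_i >= 0. *)
have := P0 ((row i U)^t*); rewrite trmxCK.
suff -> : (row i U *m P *m (row i U)^t*) 0 0 = d 0 i by [].
have -> : (row i U)^t* = col i (U^t*) by apply/matrixP => a b; rewrite !mxE.
rewrite -row_mul colE mulmxA -row_mul -colE.
by rewrite eP !mulmxA mulmxV // mul1mx mulmxtVK // !mxE eqxx mulr1n.
Qed.

Lemma trace_mul11 {R : comNzRingType} n (A : 'M[R]_(n, 1)) (q : 'M[R]_1)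
    (B : 'M[R]_(1, n)) :
  \tr (A *m q *m B) = q 0 0 * (B *m A) 0 0.
Proof.
by rewrite mxtrace_mulC mulmxA mxtrace_mulC /mxtrace big_ord1 mxE big_ord1.
Qed.

Lemma map_trmxC11 {C : numClosedFieldType} (A : 'M[C]_1) : (A^t*) 0 0 = (A 0 0)^*.
Proof. by rewrite !mxE. Qed.

Lemma trace_delta_mx2 {R : comNzRingType} n (E W : 'M[R]_n.+1) :
  \tr (delta_mx 0 0 *m E *m delta_mx 0 0 *m W) = E 0 0 * W 0 0.
Proof.
(* Each [delta_mx 0 0] is split into a column times a row, so that E is caught in a 1 x 1 block. *)
rewrite -(mul_delta_mx (0 : 'I_1)).
rewrite -!mulmxA (mulmxA _ E) (mulmxA _ _ (delta_mx 0 0 *m W)) mulmxA trace_mul11.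
by rewrite -!rowE -!colE !mxE.
Qed.

(** * Hermitian perturbation by a rank-one matrix and its adjoint *)

Section RankOne.
Variables (C : numClosedFieldType) (n : nat) (A : 'M[C]_n.+1).
Hypotheses (hA : A^t* = A) (uA : A \in unitmx).
Variables (g : 'cV[C]_n.+1) (w : 'rV[C]_n.+1).
Let B := g *m w.
Let X := invmx A *m B.
Let a := \tr X.
(** Written through A and X alone, without g and w, so that it can later be computed from an
    eigendecomposition of X. *)
Let s := \tr (X^t* *m A *m X *m invmx A).

Let trX : a = (w *m invmx A *m g) 0 0.
Proof. by rewrite /a /X /B mulmxA mxtrace_mulC mulmxA /mxtrace big_ord1. Qed.

Let sE : s = (g^t* *m invmx A *m g) 0 0 * (w *m invmx A *m w^t*) 0 0.
Proof.
rewrite /s /X /B !trmxCM trmxC_inv hA !mulmxA mulmxKV //.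
by rewrite -trace_mul11 !mulmxA.
Qed.

(** The perturbation is g (z w) + w^H (z^* g^H). In the 2 x 2 determinant the diagonal entries are 1
    + z a and, A being Hermitian, its conjugate; the off-diagonal product is z z^* s = s. *)
Lemma det_hermitian_rank1 (z : C) : z * z^* = 1 ->
  \det (A + z *: B + z^* *: B^t*) =
  \det A * (1 + z * a + (z * a)^* + a * a^* - s).
Proof.
move=> z1; rewrite /B trmxCM !scalemxAr det_add_rank2 // sE.
have -> : (z *: w *m invmx A *m g) 0 0 = z * a by rewrite -!scalemxAl mxE trX.
have -> : (z^* *: g^t* *m invmx A *m w^t*) 0 0 = (z * a)^*.
  rewrite -!scalemxAl mxE trX rmorphM /=; congr (_ * _).
  by rewrite -map_trmxC11 !trmxCM trmxC_inv hA mulmxA.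
have -> : (z *: w *m invmx A *m w^t*) 0 0 = z * (w *m invmx A *m w^t*) 0 0.
  by rewrite -!scalemxAl mxE.
have -> : (z^* *: g^t* *m invmx A *m g) 0 0 = z^* * (g^t* *m invmx A *m g) 0 0.
  by rewrite -!scalemxAl mxE.
congr (_ * _); rewrite mulrACA z1 mul1r.
have : (z * a) * (z * a)^* = a * a^* by rewrite rmorphM mulrACA z1 mul1r.
move: (z * a) (_^*) => x y <-; ring.
Qed.

(** Serves the zero-trace case of [fval]. The subtracted matrix is w^H (g^H A^-1 g) w, so
    Sylvester's identity leaves a 1 x 1 determinant. *)
Lemma det_schur_rank1 :
  \det (A - B^t* *m invmx A *m B) = \det A * (1 - s).
Proof.
have -> : A - B^t* *m invmx A *m B =
    A *m (1%:M + (invmx A *m (- w^t*)) *m (g^t* *m invmx A *m g *m w)).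
  rewrite mulmxDr mulmx1 !mulmxA mulmxV // mul1mx /B trmxCM.
  by rewrite !mulNmx.
rewrite det_mulmx det_1Dmulmx det_mx11 mulmxN sE; congr (_ * _).
rewrite mxE mxE eqxx mulmxN mxE; congr (1 - _).
by rewrite -(mulmxA _ w) (mulmxA w) mxE big_ord1.
Qed.

End RankOne.

(** * Eigendecomposition of a rank-one matrix *)

Lemma rank1_mx_diag {R : pzRingType} n (lam : R) :
  diag_mx (\row_(i < n.+1) (if i == ord0 then lam else 0)) = lam *: delta_mx 0 0.
Proof.
apply/matrixP => i j; rewrite !mxE.
case: (eqVneq i j) => [<-|]; last first.
  case: (eqVneq i 0) => [->|_]; rewrite ?mulr0 //=.
  by rewrite eq_sym => /negPf ->; rewrite mulr0.
by case: (i == ord0); rewrite ?mulr1 ?mulr0.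
Qed.

Lemma rank1_eig_trace {R : comUnitRingType} n (Y U : 'M[R]_n.+1) lam : U \in unitmx ->
  Y = U *m (lam *: delta_mx 0 0) *m invmx U -> lam = \tr Y.
Proof.
move=> uU ->; rewrite mxtrace_mulC mulmxA mulVmx // mul1mx linearZ /=.
rewrite -[X in X = _]mulr1; congr (_ * _).
rewrite /mxtrace (bigD1 0) //= big1 ?addr0 => [|i /negPf ni]; rewrite mxE ?eqxx //.
by rewrite ni.
Qed.

(** Put E = U^H A U, so that A^-1 = U E^-1 U^H; the trace then collapses to the (0, 0) entries of E
    and E^-1. As the left side does not mention U, the product of v~ and v is the same for every
    eigendecomposition. *)
Lemma rank1_eig_energy {C : numClosedFieldType} n (A Y U : 'M[C]_n.+1) lam :
  A \in unitmx -> U \in unitmx ->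
  Y = U *m (lam *: delta_mx 0 0) *m invmx U ->
  \tr (Y^t* *m A *m Y *m invmx A) =
  `|lam| ^+ 2 * ((U^t* *m A *m U) 0 0 * (invmx (U^t* *m A *m U)) 0 0).
Proof.
move=> uA uU ->; rewrite !(trmxCM, trmxCZ) trmxC_inv.
set V := U^t*; have uV : V \in unitmx by rewrite map_unitmx unitmx_tr.
set E := V *m A *m U; set W := invmx E.
have -> : invmx A = U *m W *m V.
  apply: (can_inj (mulmxK uA)); apply: (can_inj (mulmxK uU)).
  by rewrite mulVmx // mul1mx -!mulmxA (mulmxA V) mulVmx ?mulmx1 ?unitmx_mul ?uV ?uA.
rewrite !mulmxA mulmxKV //.
rewrite mxtrace_mulC !mulmxA mulmxV // mul1mx.
rewrite trmx_delta map_delta_mx -!scalemxAl -!scalemxAr -!scalemxAl !linearZ /=.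
by rewrite -(mulmxA _ V A) -(mulmxA _ (V *m A) U) trace_delta_mx2 mulrA normCK
  [lam * _]mulrC.
Qed.

(** Guarantees that [xget] in [fval] returns a true eigendecomposition and not its default. A
    nonzero trace keeps a rank-one matrix from being nilpotent, hence makes it diagonalizable. *)
Lemma rank1_eig_exists {F : fieldType} n (Y : 'M[F]_n.+1) : \rank Y = 1%N -> \tr Y != 0 ->
  exists2 U, U \in unitmx & Y = U *m (\tr Y *: delta_mx 0 0) *m invmx U.
Proof.
move=> rY tY0; have := mulmx_ebase Y; rewrite rY.
set L0 := col_ebase Y; set R0 := row_ebase Y.
have uL : L0 \in unitmx := col_ebase_unit Y.
have -> : pid_mx 1 = delta_mx 0 0 :> 'M[F]_n.+1.
  by apply/matrixP => -[[|i] ?] [[|j] ?]; rewrite !mxE ?andbF.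
move: tY0; set a := \tr Y => tY0 eY.
pose e : 'cV[F]_n.+1 := delta_mx 0 0.
(* Conjugating Y by L0 gives a (e r); dividing by the trace a normalizes r e to 1. *)
pose r : 'rV[F]_n.+1 := a^-1 *: (row 0 R0 *m L0).
have De : delta_mx 0 0 = e *m e^T :> 'M[F]_n.+1 by rewrite trmx_delta mul_delta_mx.
have ar : a *: r = e^T *m R0 *m L0.
  by rewrite /r scalerA divff // scale1r trmx_delta -rowE.
have re : r *m e = 1%:M.
  apply/matrixP => i j; rewrite !ord1 [RHS]mxE eqxx; apply: (mulfI tY0).
  have -> : a * (r *m e) 0 0 = ((a *: r) *m e) 0 0 by rewrite -scalemxAl [RHS]mxE.
  rewrite ar mulr1 /a -eY De mxtrace_mulC !mulmxA mxtrace_mulC !mulmxA.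
  by rewrite /mxtrace big_ord1.
have eTe : e^T *m e = 1%:M.
  by rewrite trmx_delta mul_delta_mx; apply/matrixP => i j; rewrite !ord1 !mxE.
have qe : (r - e^T) *m e = 0 by rewrite mulmxBl re eTe subrr.
(* Y = a (L0 e) (r L0^-1); the shear T fixes e and carries r to e^T, so L0 T
   diagonalizes Y. *)
pose T := 1%:M - e *m (r - e^T).
have Te : T *m e = e by rewrite mulmxBl mul1mx -mulmxA qe mulmx0 subr0.
have rT : r *m T = e^T by rewrite mulmxBr mulmx1 mulmxA re mul1mx subKr.
(* Since (r - e^T) e = 0, the inverse of the shear is obtained by flipping its sign. *)
have [uT _] : T \in unitmx /\ 1%:M + e *m (r - e^T) \in unitmx.
  apply: mulmx1_unit; rewrite mulmxDr mulmx1 mulmxA Te.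
  by rewrite subrK.
have uLT : L0 *m T \in unitmx by rewrite unitmx_mul uL.
exists (L0 *m T) => //; apply: (can_inj (mulmxK uLT)); rewrite mulmxKV //.
rewrite -{1}eY De !mulmxA -(mulmxA (L0 *m e)) -(mulmxA (L0 *m e)) -ar.
by rewrite -scalemxAr -scalemxAl -mulmxA rT -scalemxAr !mulmxA -(mulmxA L0 T) Te.
Qed.

(** * Closure properties of positive semidefinite matrices *)

Section PSD.
Variable R : realType.
Local Notation C := R[i].

Lemma psdmxD n (P Q : 'M[C]_n) : psdmx P -> psdmx Q -> psdmx (P + Q).
Proof.
move=> [/hermsymmxP hP P0] [/hermsymmxP hQ Q0]; split.
  by apply/hermsymmxP; rewrite trmxCD hP hQ.
by move=> x; rewrite mulmxDr mulmxDl mxE addr_ge0.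
Qed.

Lemma psdmxZ n (a : C) (P : 'M[C]_n) : 0 <= a -> psdmx P -> psdmx (a *: P).
Proof.
move=> a0 [/hermsymmxP hP P0]; split.
  apply/hermsymmxP; rewrite trmxCZ hP (CrealP _) //; exact: ger0_real.
by move=> x; rewrite -scalemxAr -scalemxAl mxE mulr_ge0.
Qed.

Lemma psdmx_congr m n (V : 'M[C]_(m, n)) (P : 'M[C]_n) :
  psdmx P -> psdmx (V *m P *m V^t*).
Proof.
move=> [/hermsymmxP hP P0]; split.
  by apply/hermsymmxP; rewrite !trmxCM trmxCK hP mulmxA.
by move=> x; have := P0 (V^t* *m x); rewrite trmxCM trmxCK !mulmxA.
Qed.

End PSD.

(** * Expansion of a received covariance in a single phase *)

Section Expand.
Variable (C : numClosedFieldType) (m n : nat).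
Variables (H S T : 'M[C]_(m, n)) (Q : 'M[C]_n) (sg b z : C).
Hypotheses (hQ : Q^t* = Q) (rsg : sg^* = sg) (rb : b^* = b) (z1 : z * z^* = 1).
Let cov (V W : 'M[C]_(m, n)) := V *m Q *m W^t*.

(** Completing the square in H and S exhibits the matrix A as the identity plus two covariances,
    which yields its positivity. *)
Lemma expand_mean : 1%:M + sg *: cov H H + (sg * b * b) *: cov S S
    + (sg * b * b) *: cov T T + (sg * b) *: (cov S H + cov H S) =
  1%:M + (sg *: cov (H + b *: S) (H + b *: S) + (sg * b * b) *: cov T T).
Proof.
rewrite /cov trmxCD trmxCZ rb !(mulmxDl, mulmxDr, =^~scalemxAl, =^~scalemxAr,
  scalerDr, scalerA).
apply/matrixP => i j; rewrite !mxE; ring.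
Qed.

Lemma expand_phase :
  let A := 1%:M + sg *: cov H H + (sg * b * b) *: cov S S
    + (sg * b * b) *: cov T T + (sg * b) *: (cov S H + cov H S) in
  let B := (sg * b) *: cov T H + (sg * b * b) *: cov T S in
  1%:M + sg *: cov (H + b *: (S + z *: T)) (H + b *: (S + z *: T)) =
  A + z *: B + z^* *: B^t*.
Proof.
rewrite /cov !(trmxCD, trmxCZ, trmxCM, trmxCK) !rmorphM /= rsg rb hQ.
rewrite !(mulmxA, mulmxDl, mulmxDr, =^~scalemxAl, =^~scalemxAr, scalerDr, scalerA).
apply/matrixP => i j; rewrite !mxE.
(* The term quadratic in T carries z z^* on the left and no phase on the right; here the condition
   |z| = 1 enters. *)
have e x : sg * b * b * x = sg * b * b * x * (z * z^*) by rewrite z1 mulr1.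
rewrite [X in _ = _ + X + _ + _ + _]e; ring.
Qed.

End Expand.

(** * The scalar functions as logarithms of determinants *)

Lemma gt0_complexE {R : realType} (x : R[i]) :
  0 < x -> x = (complex.Re x)%:C /\ 0 < complex.Re x.
Proof. by case: x => a b; rewrite ltcE /= => /andP[/eqP -> ?]. Qed.

Lemma log2M {R : realType} (x y : R) : 0 < x -> 0 < y -> log2 (x * y) = log2 x + log2 y.
Proof. by move=> x0 y0; rewrite /log2 lnM ?posrE // mulrDl. Qed.

Lemma ReM_gt0 {R : realType} (x y : R[i]) :
  0 < x -> complex.Re (x * y) = complex.Re x * complex.Re y.
Proof. by move=> /gt0_complexE[-> _]; case: y => a b; simpc. Qed.

Lemma ReD {R : realType} (x y : R[i]) :
  complex.Re (x + y) = complex.Re x + complex.Re y.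
Proof. by case: x y => [? ?] [? ?]. Qed.

Lemma ReJ {R : realType} (x : R[i]) : complex.Re (x^*) = complex.Re x.
Proof. by case: x. Qed.

Lemma fvalE (R : realType) (M N1 N2 K : nat) (sys : system R M N1 N2 K)
    (N : nat) (H : 'M[R[i]]_(N.+1, M.+1)) (G : 'M[R[i]]_(N.+1, K.+1))
    (Q : 'M[R[i]]_M.+1) (phi : 'rV[R[i]]_K.+1) (k : 'I_K.+1) (n : nat)
    (z : R[i]) (g : 'cV_N.+1) (w : 'rV_N.+1) :
  let A := Amx sys H G Q phi k n in
  let B := Bmx sys H G Q phi k n in
  A^t* = A -> 0 < \det A -> B = g *m w -> z * z^* = 1 ->
  0 < \det (A + z *: B + z^* *: B^t*) ->
  fval sys H G Q phi k n z = log2 (complex.Re (\det (A + z *: B + z^* *: B^t*))).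
Proof.
move=> A B; rewrite /fval -/A -/B; move: A B => A B hA dA eB z1.
have uA : A \in unitmx by rewrite unitmxE unitfE gt_eqF.
rewrite eB det_hermitian_rank1 // pmulr_rgt0 // -eB.
set X := invmx A *m B; set s := \tr (_ *m invmx A); move=> c0.
case: eqP => [/eqP|/eqP rX].
  rewrite mxrank_eq0 => /eqP X0.
  rewrite /s X0 mxtrace0 trmx0 map_mx0 !mul0mx mxtrace0 mulr0 rmorph0.
  by rewrite !mulr0 !addr0 subr0 mulr1.
(* B = g w bounds the rank by one, so the last branch of [fval] is exactly rank one with nonzero
   trace. *)
have {}rX : \rank X = 1%N.
  apply/eqP; rewrite eqn_leq lt0n rX andbT /X eB.
  exact: (leq_trans (mxrankM_maxr _ _) (mulmx_max_rank _ _)).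
rewrite rX eqxx /=; case: eqP => [X0|/eqP X0].
  have eS := det_schur_rank1 hA uA g w; rewrite -eB -/X -/s in eS.
  rewrite eS X0.
  by rewrite mulr0 rmorph0 !mulr0 !addr0.
(* The chosen pair is generalized, keeping only that it is an eigendecomposition; its eigenvalue and
   the product of v~ and v are then forced by the trace and energy lemmas. *)
match goal with |- context [xget ?a ?b] =>
  have := @xgetPex _ a b; move: (xget a b) end.
move=> Ul HU.
have [U0 uU0 eU0] := rank1_eig_exists rX X0.
have {HU} : rank1_eigendecomposition X Ul.1 Ul.2.
  apply: HU; exists (U0, \tr X).
  by split => //=; rewrite rank1_mx_diag.
move: Ul => [U lam] /= [uU _]; rewrite rank1_mx_diag => eX.
have elam : lam = \tr X := rank1_eig_trace uU eX.
have es := rank1_eig_energy uA uU eX; rewrite -/s in es.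
rewrite -elam in c0 *.
rewrite [in RHS]ReM_gt0 // log2M; [|by case/gt0_complexE: dA|by case/gt0_complexE: c0].
rewrite addrC; congr (_ + log2 _).
have -> : 1 + z * lam + (z * lam)^* + lam * lam^* - s =
    1 + `|lam| ^+ 2 * (1 - (U ^t* *m A *m U) 0 0 * invmx (U ^t* *m A *m U) 0 0)
    + (z * lam + (z * lam)^*).
  by rewrite es -normCK; ring.
rewrite [RHS]ReD; congr (_ + _).
by rewrite ReD ReJ -mulr2n mulr_natl.
Qed.

Lemma real_complexM {R : realType} (x y : R) : (x * y)%:C = x%:C * y%:C.
Proof. by simpc. Qed.

Lemma real_complexJ {R : realType} (x : R) : (x%:C)^* = x%:C.
Proof. by rewrite /Num.conj /= oppr0. Qed.

(** * Rates of one link as functions of the k-th phase *)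

Section Link.
Variables (R : realType) (M N1 N2 K : nat) (sys : system R M N1 N2 K).
Hypotheses (alpha_gt0 : 0 < alpha sys) (sigma2_gt0 : 0 < sigma2 sys).
Local Notation C := R[i].
Variables (N : nat) (H : 'M[C]_(N.+1, M.+1)) (G : 'M[C]_(N.+1, K.+1)).
Variables (Q : 'M[C]_M.+1) (k : 'I_K.+1).
Implicit Types phi : 'rV[C]_K.+1.
Hypothesis psdQ : psdmx Q.

Local Notation T i := (col i G *m (col i ((H3 sys)^t*))^t*).
Local Notation S phi := (\sum_(i | i != k) phi 0 i *: T i).
Local Notation sa := ((Num.sqrt (alpha sys))%:C).
Local Notation sg := ((sigma2 sys)^-1%:C).

Lemma F_split phi : F sys G phi = sa *: (S phi + phi 0 k *: T k).
Proof.
rewrite /F; congr (_ *: _).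
transitivity (\sum_i phi 0 i *: T i); last by rewrite (bigD1 k) //= addrC.
apply/matrixP => a b; rewrite mul_mx_diag mxE summxE; apply: eq_bigr => i _.
by rewrite !mxE big_ord1 !mxE conjCK mulrAC mulrC.
Qed.

(** The signed amplitude b = (-1)^n sqrt(alpha) brings the coefficients of [Amx] and [Bmx] to the
    form of [expand_phase]; its sign disappears in the square. *)
Lemma alpha_coef n (b : C) : b = (-1) ^+ n * sa ->
  (alpha sys / sigma2 sys)%:C = sg * b * b.
Proof.
move=> ->; rewrite -mulrA mulrACA -expr2 sqrr_sign mul1r -!real_complexM.
by rewrite -expr2 sqr_sqrtr ?ltW // mulrC.
Qed.

Lemma sqrt_alpha_coef n (b : C) : b = (-1) ^+ n * sa ->
  ((-1) ^+ n * (Num.sqrt (alpha sys) / sigma2 sys))%:C = sg * b.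
Proof. by move=> ->; rewrite !real_complexM rmorphXn /= rmorphN1; ring. Qed.

Lemma trmxC_rest phi : (S phi)^t* =
  \sum_(i | i != k) (phi 0 i)^* *: (col i ((H3 sys)^t*) *m (col i G)^t*).
Proof.
by rewrite trmxC_sum; apply: eq_bigr => i _; rewrite trmxCZ trmxCM trmxCK.
Qed.

Lemma Amx_split phi n (b : C) : b = (-1) ^+ n * sa ->
  Amx sys H G Q phi k n =
  1%:M + sg *: (H *m Q *m H^t*) + (sg * b * b) *: (S phi *m Q *m (S phi)^t*)
  + (sg * b * b) *: (T k *m Q *m (T k)^t*)
  + (sg * b) *: (S phi *m Q *m H^t* + H *m Q *m (S phi)^t*).
Proof.
move=> bE; rewrite /Amx (alpha_coef bE) (sqrt_alpha_coef bE) trmxC_rest.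
congr (_ + _ + _ *: _ + _ *: _).
  by rewrite trmxCM trmxCK !mulmxA.
rewrite big_split /= !mulmx_suml mulmx_sumr; congr (_ + _); apply: eq_bigr => i _.
  by rewrite -!scalemxAl.
by rewrite -scalemxAr !mulmxA.
Qed.

Lemma Bmx_split phi n (b : C) : b = (-1) ^+ n * sa ->
  Bmx sys H G Q phi k n =
  (sg * b) *: (T k *m Q *m H^t*) + (sg * b * b) *: (T k *m Q *m (S phi)^t*).
Proof.
move=> bE; rewrite /Bmx (alpha_coef bE) (sqrt_alpha_coef bE) trmxC_rest.
congr (_ *: _ + _ *: _).
by rewrite mulmx_sumr; apply: eq_bigr => i _; rewrite -scalemxAr !mulmxA.
Qed.

Lemma fval_rate phi n : phi 0 k * (phi 0 k)^* = 1 ->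
  let V := H + (-1) ^+ n *: F sys G phi in
  fval sys H G Q phi k n (phi 0 k) =
  log2 (complex.Re (\det (1%:M + sg *: (V *m Q *m V^t*)))).
Proof.
move=> z1 V.
have [/hermsymmxP hQ _] := psdQ.
pose b : C := (-1) ^+ n * sa; have bE : b = (-1) ^+ n * sa by [].
have rsg : sg^* = sg by rewrite real_complexJ.
have rb : b^* = b.
  rewrite /b rmorphM rmorphXn rmorphN1 /=; congr (_ * _); exact: real_complexJ.
have sg0 : 0 <= sg by rewrite lecR invr_ge0 ltW.
have sgb0 : 0 <= sg * b * b.
  by rewrite -mulrA mulr_ge0 // -{1}rb mulrC -normCK exprn_ge0.
have eV : 1%:M + sg *: (V *m Q *m V^t*) =
  Amx sys H G Q phi k n + phi 0 k *: Bmx sys H G Q phi k n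
  + (phi 0 k)^* *: (Bmx sys H G Q phi k n)^t*.
  rewrite (Amx_split phi bE) (Bmx_split phi bE) /V F_split scalerA -/b.
  exact: (expand_phase H (S phi) (T k) hQ rsg rb z1).
rewrite eV.
(* A is the identity plus a positive semidefinite matrix, hence Hermitian with positive
   determinant. *)
have [P psdP eA] : exists2 P, psdmx P & Amx sys H G Q phi k n = 1%:M + P.
  eexists; last by rewrite (Amx_split phi bE) (expand_mean H (S phi) (T k) Q sg rb).
  exact: (psdmxD (psdmxZ sg0 (psdmx_congr _ psdQ)) (psdmxZ sgb0 (psdmx_congr _ psdQ))).
(* Both terms of B begin with column k of G; the row factor is left to unification. *)
apply: (fvalE (g := col k G)).
- by rewrite eA trmxCD trmx1 map_mx1; case: psdP => /hermsymmxP ->.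
- rewrite eA; exact: det_1Dpsd psdP.
- by rewrite (Bmx_split phi bE) -!mulmxA !scalemxAr -mulmxDr.
- by [].
- rewrite -eV; exact: (det_1Dpsd (psdmxZ sg0 (psdmx_congr V psdQ))).
Qed.

(** The sums in A and B skip the index k, so entry k of the phase vector may be replaced by its
    update. *)
Lemma fval_ext phi phi' n z : (forall i, i != k -> phi 0 i = phi' 0 i) ->
  fval sys H G Q phi k n z = fval sys H G Q phi' k n z.
Proof.
move=> e; rewrite /fval.
have eS (U : nmodType) (f : C -> 'I_K.+1 -> U) :
    \sum_(i | i != k) f (phi 0 i) i = \sum_(i | i != k) f (phi' 0 i) i.
  by apply: eq_bigr => i /e ->.
have -> : Amx sys H G Q phi k n = Amx sys H G Q phi' k n.
  rewrite /Amx (eS _ (fun x i => x *: T i)).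
  rewrite (eS _ (fun x i => x^* *: (col i ((H3 sys)^t*) *m (col i G)^t*))).
  by rewrite (eS _ (fun x i => x *: (T i *m Q *m H^t*) +
    x^* *: (H *m Q *m col i ((H3 sys)^t*) *m (col i G)^t*))).
have -> // : Bmx sys H G Q phi k n = Bmx sys H G Q phi' k n.
by rewrite /Bmx (eS _ (fun x i =>
  x^* *: (T k *m Q *m col i ((H3 sys)^t*) *m (col i G)^t*))).
Qed.

Lemma rateE phi : phi 0 k * (phi 0 k)^* = 1 ->
  rate sys H G Q phi =
  (fval sys H G Q phi k 1 (phi 0 k) + fval sys H G Q phi k 2 (phi 0 k)) / 2.
Proof.
(* n = 1 carries the sign -1 and n = 2 the sign +1, the reverse of the order of summation in
   [rate]. *)
move=> z1; rewrite (fval_rate 1 z1) (fval_rate 2 z1) expr1 sqrrN expr1n.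
rewrite /rate mulrC big_cons big_cons big_nil.
by congr (_ / 2); rewrite [LHS]addrC; congr (_ + _); exact: addr0.
Qed.

End Link.

(** * Backscatter SNR and feasibility after a phase update *)

Lemma expi_unit {R : realType} (t : R) : expi t * (expi t)^* = 1.
Proof.
rewrite /expi /Num.conj /=; apply/eqP; rewrite eq_complex /=.
by rewrite mulrN opprK -!expr2 cos2Dsin2 mulrN [sin t * _]mulrC addNr !eqxx.
Qed.

Lemma trace_form_conj {C : numClosedFieldType} m n (Q : 'M[C]_n) (V W : 'M[C]_(m, n)) :
  Q^t* = Q -> \tr (W *m Q *m V^t*) = (\tr (V *m Q *m W^t*))^*.
Proof.
move=> hQ; rewrite -[RHS]trace_map_mx -[RHS]mxtrace_tr map_trmx.
by rewrite !trmxCM trmxCK hQ mulmxA.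
Qed.

Section Phase.
Variables (R : realType) (M N1 N2 K : nat) (sys : system R M N1 N2 K).
Hypotheses (alpha_gt0 : 0 < alpha sys) (sigma2_gt0 : 0 < sigma2 sys).
Hypotheses (Rs_gt0 : 0 < Rs sys) (gamma_gt0 : 0 < gamma sys).
Local Notation C := R[i].
Variables (Q : 'M[C]_M.+1) (k : 'I_K.+1).
Hypothesis psdQ : psdmx Q.
Implicit Types phi : 'rV[C]_K.+1.

Local Notation T i := (col i (G2 sys) *m (col i ((H3 sys)^t*))^t*).
Local Notation S phi := (\sum_(i | i != k) phi 0 i *: T i).

Lemma trace_cov (i1 i2 : 'I_K.+1) :
  \tr (T i1 *m Q *m (T i2)^t*) =
  ((col i2 (G2 sys))^t* *m col i1 (G2 sys)) 0 0
  * ((col i1 ((H3 sys)^t*))^t* *m Q *m col i2 ((H3 sys)^t*)) 0 0.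
Proof. by rewrite trmxCM trmxCK !mulmxA -2!(mulmxA (col i1 _)) trace_mul11 mulrC. Qed.

(** Splitting F into phase k and the rest, the two squares add up to [Ak] because z z^* = 1, and the
    cross terms are conjugate because Q is Hermitian, leaving 2 Re (z Bk). *)
Lemma gamma_bcE phi : phi 0 k * (phi 0 k)^* = 1 ->
  gamma_bc sys Q phi = f3 sys Q phi k (phi 0 k).
Proof.
move=> z1; have [/hermsymmxP hQ _] := psdQ.
have BkE : Bk sys Q phi k = \tr (T k *m Q *m (S phi)^t*).
  rewrite trmxC_sum mulmx_sumr linear_sum; apply: eq_bigr => i _ /=.
  by rewrite trmxCZ -scalemxAr linearZ /= trace_cov mulrA.
have AkE : Ak sys Q phi k = \tr (T k *m Q *m (T k)^t*) + \tr (S phi *m Q *m (S phi)^t*).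
  rewrite /Ak trace_cov; congr (_ + _).
  rewrite !mulmx_suml linear_sum; apply: eq_bigr => i1 _ /=.
  rewrite trmxC_sum mulmx_sumr linear_sum; apply: eq_bigr => i2 _ /=.
  by rewrite trmxCZ -!scalemxAr -!scalemxAl !linearZ /= trace_cov; ring.
have BJ : \tr (S phi *m Q *m (T k)^t*) = (Bk sys Q phi k)^*.
  rewrite BkE; exact: trace_form_conj.
rewrite /gamma_bc /f3 (F_split _ _ k).
set sa := (_%:C).
have -> : (sa *: (S phi + phi 0 k *: T k)) *m Q *m (sa *: (S phi + phi 0 k *: T k))^t* =
  (alpha sys)%:C *: ((S phi + phi 0 k *: T k) *m Q *m (S phi + phi 0 k *: T k)^t*).
  rewrite trmxCZ real_complexJ -!scalemxAl -scalemxAr scalerA -real_complexM.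
  by rewrite -expr2 sqr_sqrtr ?ltW.
have -> : \tr ((alpha sys)%:C *: ((S phi + phi 0 k *: T k) *m Q *m (S phi + phi 0 k *: T k)^t*)) =
   (alpha sys)%:C * (Ak sys Q phi k + (phi 0 k * Bk sys Q phi k + (phi 0 k * Bk sys Q phi k)^*)).
  rewrite linearZ /=; congr (_ * _).
  rewrite trmxCD trmxCZ !(mulmxDl, mulmxDr, =^~scalemxAl, =^~scalemxAr).
  rewrite !(linearD, linearZ) /= BJ -BkE AkE rmorphM /=.
  rewrite !mulrA z1 mul1r; ring.
rewrite ReM_gt0 ?ltcR // !ReD ReJ /=; ring.
Qed.

Lemma f3_ext phi phi' z : (forall i, i != k -> phi 0 i = phi' 0 i) ->
  f3 sys Q phi k z = f3 sys Q phi' k z.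
Proof.
move=> e; rewrite /f3.
have -> : Ak sys Q phi k = Ak sys Q phi' k.
  congr (_ + _); apply: eq_bigr => i1 /e e1; apply: eq_bigr => i2 /e e2.
  by rewrite e1 e2.
have -> // : Bk sys Q phi k = Bk sys Q phi' k.
by apply: eq_bigr => i /e ->.
Qed.

(** The ratios are computed at the phases before the update and feasibility is claimed after it;
    [fval_ext] and [f3_ext] bridge the two, and clearing the denominators 2 Rs and gamma gives the
    constraints. *)
Lemma ratios_ge_feasible phi phi' (z : C) : z * z^* = 1 -> phi' 0 k = z ->
  (forall i, i != k -> phi 0 i = phi' 0 i) ->
  ratios_ge sys Q phi k z 1 -> feasibleQ sys phi' Q.
Proof.
move=> z1 zE e [r1 r2 r3].
have z1' : phi' 0 k * (phi' 0 k)^* = 1 by rewrite zE.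
split => //.
- rewrite /Rp (rateE alpha_gt0 sigma2_gt0 _ _ psdQ z1') zE.
  move: r1; rewrite /f1 (fval_ext _ _ _ _ 1 z e) (fval_ext _ _ _ _ 2 z e).
  by rewrite !ler_pdivlMr ?mulr_gt0 // mul1r mulrC.
- rewrite /Rbs (rateE alpha_gt0 sigma2_gt0 _ _ psdQ z1') zE.
  move: r2; rewrite /f2 (fval_ext _ _ _ _ 1 z e) (fval_ext _ _ _ _ 2 z e).
  by rewrite !ler_pdivlMr ?mulr_gt0 // mul1r mulrC.
- move: r3; rewrite gamma_bcE // zE ler_pdivlMr // mul1r => /le_trans; apply.
  by rewrite (f3_ext _ e).
Qed.

End Phase.

(** * Descent of the transmit power *)

Theorem theorem2 (R : realType) (M N1 N2 K : nat) (sys : system R M N1 N2 K)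
  (alpha_gt0 : 0 < alpha sys) (sigma2_gt0 : 0 < sigma2 sys)
  (Rs_gt0 : 0 < Rs sys) (gamma_gt0 : 0 < gamma sys) (L_gt0 : (0 < L sys)%N)
  (Q : nat -> 'M[R[i]]_M.+1) (phi : nat -> 'rV[R[i]]_K.+1)
  (run : ao_iterates sys Q phi) :
  forall t : nat, (2 <= t)%N -> power (Q t) <= power (Q t.-1).
Proof.
(* With the index written as t + 2, Q(t+1) is optimal for phi(t) and Q(t+2) for phi(t+1), so
   feasibility of Q(t+1) at phi(t+1) suffices. *)
move=> [|[|t]] // _ /=; have [_ step] := run.
have [[feas _] upd] := step t; have [[_ opt] _] := step t.+1.
apply: opt.
have psdQ : psdmx (Q t.+1) by case: feas.
(* The phases after j updates of the inner loop: [mix 0] is phi(t), [mix K.+1] is phi(t+1), and for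
   j <= K [mix j] is the vector at which update j is tested. Induction on j carries feasibility
   along. *)
pose mix (j : nat) : 'rV[R[i]]_K.+1 :=
  \row_i (if (i < j)%N then phi t.+1 0 i else phi t 0 i).
suff mixP j : (j <= K.+1)%N -> feasibleQ sys (mix j) (Q t.+1).
  have <- : mix K.+1 = phi t.+1 by apply/rowP => i; rewrite mxE ltn_ord.
  exact: mixP.
elim: j => [_|j IHj ltjK].
  by have -> : mix 0 = phi t by apply/rowP => i; rewrite mxE.
have /= [z [tau [u [_ _ acc rej]]]] := upd (Ordinal ltjK).
have mixS i : i != Ordinal ltjK -> mix j 0 i = mix j.+1 0 i.
  by rewrite -val_eqE /= => nij; rewrite !mxE ltnS [(i <= j)%N]leq_eqVlt (negPf nij).
have mixj : mix j.+1 0 (Ordinal ltjK) = phi t.+1 0 (Ordinal ltjK).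
  by rewrite mxE /= ltnSn.
(* An accepted phase passes the three ratio tests, which give feasibility; a rejected one leaves the
   phase vector unchanged. *)
have [ok|nok] := pselect (ratios_ge sys (Q t.+1) (mix j) (Ordinal ltjK) (expi u) 1).
  exact: (ratios_ge_feasible alpha_gt0 sigma2_gt0 Rs_gt0 gamma_gt0 psdQ
    (expi_unit u) (etrans mixj (acc ok)) mixS ok).
have -> : mix j.+1 = mix j.
  apply/rowP => i; have [->|/mixS/esym //] := eqVneq i (Ordinal ltjK).
  by rewrite mixj rej // mxE /= ltnn.
exact/IHj/ltnW.
Qed.
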